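(* Let $N\ge 1$, let $\phi$ be a strictly positive functional on $\mathcal P_N$, let $s_\sigma=\phi(X_\sigma)$, $\sigma\in\mathbb F_N^+$, be its moments, and let $\mathcal A=\{A_{n,k},B_{m,k}\mid n>0,\ m\ge 0,\ k=1,\ldots,N\}$ be the admissible family of matrices associated with $\phi$ by the three-term relation $$X_k\Phi_n=\Phi_{n+1}A_{n+1,k}+\Phi_nB_{n,k}+\Phi_{n-1}A_{n,k}^*,\qquad k=1,\ldots,N,\ n\ge 0.$$ Then the moments of $\phi$ are given by $$s_\sigma=\sum_{\mathbf p\in\mathcal M_\sigma}w(\mathbf p),\qquad \sigma\in\mathbb F_N^+\setminus\{\emptyset\},$$ where $\mathcal M_\sigma$ is the set of lattice paths attached to $\sigma$ and $w(\mathbf p)$ is the weight of the path $\mathbf p$ determined by $\mathcal A$ (a $1\times1$ matrix is identified with its entry).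
   Context: **Words and polynomials.** $\mathbb N_0=\{0,1,2,\ldots\}$. $\mathbb F_N^+$ is the free unital semigroup (words) on the letters $1,\ldots,N$, with identity the empty word $\emptyset$; $|\sigma|$ is the length of $\sigma$, and $I(i_1\cdots i_l)=i_l\cdots i_1$. Words are ordered by $\prec$: shorter words first, words of equal length lexicographically. $\mathcal P_N$ is the algebra of complex polynomials in $N$ non-commuting indeterminates $X_1,\ldots,X_N$; $X_\sigma=X_{i_1}\cdots X_{i_l}$ for $\sigma=i_1\cdots i_l$, $X_\emptyset=1$. It carries the involution $\left(\sum c_\sigma X_\sigma\right)^+=\sum\overline{c_\sigma}X_{I(\sigma)}$. **Strictly positive functional.** A linear map $\phi:\mathcal P_N\to\mathbb C$ with $\phi(1)=1$ and $\phi(P^+P)>0$ for all $P\in\mathcal P_N\setminus\{0\}$. Put $\langle P_1,P_2\rangle_\phi=\phi(P_2^+P_1)$. **Orthonormal polynomials.** Gram–Schmidt applied to $\{X_\sigma\}$ in the order $\prec$ gives the unique family $\varphi_\alpha=\sum_{\beta\preceq\alpha}a_{\alpha,\beta}X_\beta$ with $a_{\alpha,\alpha}>0$ and $\langle\varphi_\alpha,\varphi_\beta\rangle_\phi=\delta_{\alpha,\beta}$, $\alpha,\beta\in\mathbb F_N^+$. Let $\Phi_n=[\varphi_\sigma]_{|\sigma|=n}$ be the row vector of length $N^n$ (entries in lexicographic order), $n\ge0$, and $\Phi_{-1}=0$. **Admissible family.** A family of complex matrices $\{A_{n,k},B_{m,k}\mid n>0,\ m\ge0,\ k=1,\ldots,N\}$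 such that each $B_{m,k}$ is a selfadjoint $N^m\times N^m$ matrix, each $A_{n,k}$ is an $N^n\times N^{n-1}$ matrix, and for every $n\ge1$ the $N^n\times N^n$ matrix $A_n=[A_{n,1}\ \cdots\ A_{n,N}]$ is upper triangular and invertible with strictly positive diagonal entries. It is known that for every strictly positive $\phi$ there is a unique family of matrices for which the three-term relation in the claim holds for all $k=1,\ldots,N$, $n\ge0$ (the term with $\Phi_{-1}$ being $0$), and that it is admissible; this is the family associated with $\phi$. **Paths.** Paths live in $\mathbb N_0\times\{1,\ldots,N\}\times\mathbb N_0$. The allowed steps and their weights are: - level step $l^k_{n,m}$ from $(n,k,m)$ to $(n+1,k,m)$, weight $B_{m,k}$; - transition step $lp^n_{m,k}$ from $(n,k,m)$ to $(n,p,m)$ with $p\in\{1,\ldots,N\}\setminus\{k\}$, weight the identity matrix of size $N^m$; - rise step $r^k_{n,m}$ from $(n,k,m)$ to $(n+1,k,m+1)$, weight $A_{m+1,k}$; - fall step $f^k_{n,m}$ from $(n,k,m)$ to $(n+1,k,m-1)$ (for $m\ge1$), weight $A_{m,k}^*$. If $\mathbf p$ consists of the consecutive steps step $1,\ldots,$ step $l$, then $w(\mathbf p)=w(\text{step }l)\cdots w(\text{step }1)$. **The set $\mathcal M_\sigma$.** Write $\sigma\ne\emptyset$ uniquely as $\sigma=i_1^{k_1}\cdots i_p^{k_p}$ with $i_j\in\{1,\ldots,N\}$, $k_j>0$, $i_l\ne i_{l+1}$ for $l=1,\ldots,p-1$. Then $\mathcal M_\sigma$ is the set of all paths from $(0,i_p,0)$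 to $(|\sigma|,i_1,0)$ that consist of $k_p$ steps (level, rise or fall) in $\mathbb N_0\times\{i_p\}\times\mathbb N_0$, then $k_{p-1}$ steps (level, rise or fall) in $\mathbb N_0\times\{i_{p-1}\}\times\mathbb N_0$, and so on, ending with $k_1$ steps (level, rise or fall) in $\mathbb N_0\times\{i_1\}\times\mathbb N_0$, where between the steps with second coordinate $i_{j+1}$ and those with second coordinate $i_j$ there is exactly one transition step, from second coordinate $i_{j+1}$ to $i_j$. *)

(* Defs.v *)
From HB Require Import structures.
From mathcomp Require Import all_boot all_order all_algebra.
From mathcomp Require Import finmap.
From mathcomp Require Import boolp classical_sets functions cardinality fsbigop.
From mathcomp Require Import reals complex monalg.

Set Implicit Arguments.
Unset Strict Implicit.
Unset Printing Implicit Defensive.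

Import Order.TTheory GRing.Theory Num.Theory.
Local Open Scope ring_scope.
Local Open Scope sesquilinear_scope.

(* The letters 1, ..., N are the elements 0, ..., N-1 of 'I_N; the product of
   {fmonom 'I_N} is concatenation and its unit is the empty word. *)
Notation word N := {fmonom 'I_N}.
Notation ncpoly R N := {malg R[i][word N]}.

Section Words.
Variable N : nat.
Implicit Types s t : word N.

Definition word_rev s : word N := FMonom (rev s).

Definition word_le s t : bool :=
  (size s < size t)%N ||
  ((size s == size t) &&
     ((fmonom_val s : seqlexi 'I_N) <= (fmonom_val t : seqlexi 'I_N))%O).

Fixpoint letters_seqs (n : nat) : seq (seq 'I_N) :=
  if n is m.+1 then [seq i :: u | i <- enum 'I_N, u <- letters_seqs m]
  else [:: [::]].

Definition words (n : nat) : seq (word N) := map (@FMonom _) (letters_seqs n).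

Lemma size_words n : size (words n) = (N ^ n)%N.
Proof.
rewrite size_map; elim: n => //= n IHn.
by rewrite size_allpairs IHn -cardE card_ord expnS.
Qed.

Lemma mem_words n s : (s \in words n) = (size s == n).
Proof.
have memE u : (u \in letters_seqs n) = (size u == n).
  elim: n u => [|n IHn] [|i u] //=.
    by apply/allpairsP => -[[j v] /= [_ _]].
  rewrite eqSS -IHn; apply/allpairsP/idP => [[[j v] /= [_ vin [_ ->]]]|uin] //.
  by exists (i, u); split=> //=; rewrite mem_enum.
by case: s => s; rewrite /words mem_map ?memE // => u v [].
Qed.

Lemma words_sorted n :
  sorted [rel s t | (s != t) && word_le s t] (words n).
Proof.
have sizeP u : u \in letters_seqs n -> size u = n.
  by move=> uin; apply/eqP; rewrite -(mem_words n (FMonom u)) map_f.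
have: pairwise (fun u v : seqlexi 'I_N => u < v)%O (letters_seqs n).
  elim: n {sizeP} => [|n IHn] //=.
  have: pairwise (fun i j : 'I_N => i < j)%O (enum 'I_N).
    rewrite -(@pairwise_map _ _ val ltn) val_enum_ord.
    by rewrite -sorted_pairwise ?iota_ltn_sorted //; apply: ltn_trans.
  elim: (enum 'I_N) => [|i e IHe] //= /andP[/allP ie /IHe{}IHe].
  rewrite pairwise_cat IHe andbT; apply/andP; split.
    apply/allrelP => _ _ /mapP[u _ ->] /allpairsP[[j v] /= [jin _ ->]].
    by rewrite Order.SeqLexiOrder.ltxi_cons (ltW (ie _ jin)) (lt_geF (ie _ jin)).
  rewrite pairwise_map; apply: sub_pairwise IHn => u v /= uv.
  by rewrite Order.SeqLexiOrder.ltxi_cons lexx /=.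
rewrite /words sorted_map => /pairwise_sorted.
apply: (@sub_in_sorted _ (mem (letters_seqs n))); last exact/allP.
move=> u v /sizeP su /sizeP sv /= uv; rewrite /word_le /= su sv eqxx ltW // orbT.
by rewrite andbT; apply/eqP => -[uvE]; rewrite uvE ltxx in uv.
Qed.

End Words.

Section Functional.
Variables (R : realType) (N : nat).
Local Notation C := R[i].
Local Notation P := (ncpoly R N).
Implicit Types (p q : P) (s t : word N).

Definition indet (k : 'I_N) : P := << FMonom [:: k] >>.

Definition poly_adj p : P :=
  \sum_(s <- msupp p) << (p@_s)^* *g word_rev s >>.

Variable phi : {scalar P}.

(* In R[i], 0 < z means that z is real and positive. *)
Definition strictly_positive : Prop :=
  phi 1 = 1 /\ forall p, p != 0 -> 0 < phi (poly_adj p * p).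

Definition moment s : C := phi << s >>.

Definition inner p q : C := phi (poly_adj q * p).

Definition orthonormal_polys (vphi : word N -> P) : Prop :=
  [/\ forall s t, t \in msupp (vphi s) -> word_le t s,
      forall s, 0 < (vphi s)@_s
    & forall s t, inner (vphi s) (vphi t) = (s == t)%:R].

End Functional.

Section Matrices.
Variables (R : realType) (N : nat).
Local Notation C := R[i].
Local Notation P := (ncpoly R N).

(* A n k is A_{n,k}; the matrices A 0 k are not part of the family, they are
   not constrained by [admissible] and do not contribute to what follows. *)
Variable A : forall n : nat, 'I_N -> 'M[C]_(N ^ n, N ^ n.-1).
Variable B : forall n : nat, 'I_N -> 'M[C]_(N ^ n).

Lemma sum_expn n : (\sum_(k < N) N ^ n)%N = (N ^ n.+1)%N.
Proof. by rewrite sum_nat_const card_ord expnS. Qed.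

(* The matrix A_{n+1} = [A_{n+1,1} ... A_{n+1,N}]. *)
Definition block_row (n : nat) : 'M[C]_(N ^ n.+1) :=
  castmx (erefl, sum_expn n) (\mxrow_(k < N) A n.+1 k).

Definition admissible : Prop :=
  (forall n k, (B n k)^t* = B n k) /\
  (forall n, [/\ forall i j : 'I_(N ^ n.+1), (j < i)%N -> block_row n i j = 0,
                 block_row n \in unitmx
               & forall i, 0 < block_row n i i]).

Variable vphi : word N -> P.

Definition Phi (n : nat) : 'rV[P]_(N ^ n) :=
  \row_j vphi (nth (FMonom [::]) (words N n) j).

Definition Phi_pred (n : nat) : 'rV[P]_(N ^ n.-1) :=
  if n is m.+1 then Phi m else 0.

Definition const_mx_poly m n (M : 'M[C]_(m, n)) : 'M[P]_(m, n) :=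
  map_mx (fun c => c%:MP) M.

Definition three_term : Prop := forall n k,
  indet R k *: Phi n = Phi n.+1 *m const_mx_poly (A n.+1 k)
                       + Phi n *m const_mx_poly (B n k)
                       + Phi_pred n *m const_mx_poly ((A n k)^t*).

End Matrices.

Inductive lstep (N : nat) :=
  Level | Transition of 'I_N | Rise | Fall.
Arguments Level {N}.
Arguments Transition {N}.
Arguments Rise {N}.
Arguments Fall {N}.

Section StepInstances.
Variable N : nat.

Definition lstep_code (e : lstep N) : option 'I_N + bool :=
  match e with
  | Level => inl None | Transition k => inl (Some k)
  | Rise => inr true | Fall => inr false
  end.

Definition lstep_decode (c : option 'I_N + bool) : lstep N :=
  match c with
  | inl None => Level | inl (Some k) => Transition k
  | inr true => Rise | inr false => Fall
  end.

Lemma lstep_codeK : cancel lstep_code lstep_decode. Proof. by case. Qed.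

HB.instance Definition _ := Finite.copy (lstep N) (can_type lstep_codeK).

End StepInstances.

Section Paths.
Variables (R : realType) (N : nat).
Local Notation C := R[i].

Definition vertex : Type := nat * 'I_N * nat.
Implicit Types (v : vertex) (e : lstep N).

Definition next v e : vertex :=
  match e with
  | Level => (v.1.1.+1, v.1.2, v.2)
  | Transition k => (v.1.1, k, v.2)
  | Rise => (v.1.1.+1, v.1.2, v.2.+1)
  | Fall => (v.1.1.+1, v.1.2, v.2.-1)
  end.

Definition allowed v e : bool :=
  match e with
  | Transition k => k != v.1.2
  | Fall => (0 < v.2)%N
  | _ => true
  end.

(* A path is encoded by its initial vertex and the sequence of its steps. *)
Definition lpath : Type := vertex * seq (lstep N).

Fixpoint steps_allowed v (es : seq (lstep N)) : bool :=
  if es is e :: es' then allowed v e && steps_allowed (next v e) es' else true.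

Fixpoint target v (es : seq (lstep N)) : vertex :=
  if es is e :: es' then target (next v e) es' else v.

Variable A : forall n : nat, 'I_N -> 'M[C]_(N ^ n, N ^ n.-1).
Variable B : forall n : nat, 'I_N -> 'M[C]_(N ^ n).

Definition step_weight v e : 'M[C]_(N ^ (next v e).2, N ^ v.2) :=
  match e with
  | Level => B v.2 v.1.2
  | Transition _ => 1%:M
  | Rise => A v.2.+1 v.1.2
  | Fall => (A v.2 v.1.2)^t*
  end.

Fixpoint steps_weight v (es : seq (lstep N)) :
    'M[C]_(N ^ (target v es).2, N ^ v.2) :=
  if es is e :: es' then steps_weight (next v e) es' *m step_weight v e
  else 1%:M.

(* The weight of a path from height 0 to height 0 is a 1 x 1 matrix, which
   conform_mx returns unchanged. *)
Definition path_weight (p : lpath) : C :=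
  conform_mx (0 : 'M[C]_1) (steps_weight p.1 p.2) 0 0.

End Paths.

Section PathSets.
Variable N : nat.
Implicit Types (s : seq 'I_N) (r : seq ('I_N * nat)).

Definition add_letter (i : 'I_N) r :=
  if r is (j, k) :: r' then if i == j then (j, k.+1) :: r' else (i, 1%N) :: r
  else [:: (i, 1%N)].

(* The sequence (i_1, k_1), ..., (i_p, k_p) such that s = i_1^k_1 ... i_p^k_p,
   as characterized by runsP. *)
Definition runs s : seq ('I_N * nat) := foldr add_letter [::] s.

Lemma runsP s r :
  runs s = r <->
  [/\ s = flatten [seq nseq x.2 x.1 | x <- r],
      all (fun x => 0 < x.2)%N r
    & sorted (fun x y : 'I_N * nat => x.1 != y.1) r].
Proof.
split=> [<-|].
  elim: s => //= i s; case: (runs s) => [|[j k] r'] [/= IH1 IH2 IH3].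
    by rewrite {1}IH1.
  case: eqP => [->|/eqP ij]; last by split=> /=; rewrite ?ij // {1}IH1.
  case/andP: IH2 => _ IH2; split=> //=; first by rewrite {1}IH1.
  by case: r' IH3 {IH1 IH2}.
case=> ->; elim: r {s} => [|[i k] r IHr] //= /andP[k0 rpos] rs.
rewrite /runs foldr_cat -/(runs _) IHr ?(path_sorted rs) //.
case: k k0 rs => // k _ rs /=; elim: k rs => [|k IHk] rs /=.
  by case: r rs {IHr rpos} => [|[j l] r] //= /andP[/negPf->].
rewrite IHk; first by rewrite /= eqxx.
by case: (r) rs.
Qed.

Definition transition_letter (e : lstep N) : option 'I_N :=
  if e is Transition k then Some k else None.

(* For r = (i_p, k_p), ..., (i_1, k_1): k_p steps that are not transitions,
   the transition to i_{p-1}, k_{p-1} steps that are not transitions, etc.;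
   these steps lie in the right planes because only transitions change the
   second coordinate. *)
Definition itinerary r : seq (option 'I_N) :=
  if r is (_, k) :: r' then
    nseq k None ++ flatten [seq Some x.1 :: nseq x.2 None | x <- r']
  else [::].

Definition path_set (s : word N) : set (lpath N) :=
  if rev (runs s) is (i, k) :: r then
    [set p | [/\ p.1 = (0%N, i, 0%N),
                 steps_allowed p.1 p.2,
                 target p.1 p.2 = (size s, (last (i, k) r).1, 0%N)
               & map transition_letter p.2 = itinerary ((i, k) :: r)]]
  else set0.

Lemma finite_path_set (s : word N) : finite_set (path_set s).
Proof.
rewrite /path_set; case: (rev _) => [|[i k] r]; first exact: finite_set0.
pose l := size (itinerary ((i, k) :: r)).
pose f (es : l.-tuple (lstep N)) : lpath N := ((0%N, i, 0%N), tval es).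
apply: (@sub_finite_set _ _ (f @` setT)%classic).
  move=> [v es] [/= -> _ _ /(congr1 size) esE].
  have szE : size es == l by apply/eqP; rewrite -[LHS](size_map transition_letter).
  by exists (Tuple szE).
exact/finite_image/finite_finset.
Qed.

End PathSets.

(* Main.v *)
Require Import Defs.
From HB Require Import structures.
From mathcomp Require Import all_boot all_order all_algebra.
From mathcomp Require Import finmap.
From mathcomp Require Import boolp classical_sets functions cardinality fsbigop.
From mathcomp Require Import reals complex monalg.

Set Implicit Arguments.
Unset Strict Implicit.
Unset Printing Implicit Defensive.

Import Order.TTheory GRing.Theory Num.Theory.
Local Open Scope ring_scope.

(** The three-term relation says how multiplication by X_k acts in the basis
    (vphi_t): it sends the coordinates at height m to the heights m+1, m, m-1
    through the matrices A_{m+1,k}, B_{m,k}, A_{m,k}^*, the weights of the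
    rise, level and fall steps.  Expanding X_s = X_{i_1} ... X_{i_n} 1 from the
    right, starting at 1 = vphi_0 (height 0), gives one term per path, whose
    coefficient is the weight of the path; as phi kills vphi_t for t nonempty,
    phi(X_s) keeps exactly the paths that come back to height 0.

    The induction goes over the steps from the first one on, so the statement
    must speak of paths issued from any vertex, at any height m: for a starting
    letter i and an itinerary o that together read the word w backwards, the
    sum of the weights of the walks that follow o down to height 0 is the row
    vector phi(X_w Phi_m) (weight_sum_walks).  Peeling off the first step
    replaces Phi_m by X_i Phi_m, to which the three-term relation applies.
    Transition steps only change the letter that is read next, and have weight
    1, so they can stay in the walks and no bijection with paths without
    transitions has to be set up.

    What remains is combinatorial: an itinerary determines the first two
    coordinates of the end point (target_walk), hence path_set s is the set of
    the walks along the itinerary of the runs of s that end at height 0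
    (path_setE). *)

(** * Moments of rows of polynomials *)

Section MomentRow.
Variables (R : realType) (N : nat) (phi : {scalar ncpoly R N}).
Local Notation C := R[i].
Local Notation P := (ncpoly R N).

Lemma mulr_malgC (q : P) (c : C) : q * c%:MP = c *: q.
Proof.
rewrite [q]monalgE mulr_suml scaler_sumr; apply: eq_bigr => t _.
rewrite malgM_def fgmulUU mulm1 mulrC.
by apply/malgP => u; rewrite mcoeffZ !mcoeffU mulrnAr.
Qed.

Lemma fmonom_cat (u v : seq 'I_N) :
  << FMonom (u ++ v) >> = << FMonom u >> * << FMonom v >> :> P.
Proof. by rewrite malgM_def fgmulUU mulr1 -(fmmulE (FMonom u) (FMonom v)). Qed.

Definition moment_row n (s : word N) (M : 'rV[P]_n) : 'rV[C]_n :=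
  map_mx (fun q => phi (<< s >> * q)) M.

Lemma moment_rowE n s (M : 'rV[P]_n) i j :
  moment_row s M i j = phi (<< s >> * M i j).
Proof. by rewrite mxE. Qed.

Lemma moment_rowD n s (M1 M2 : 'rV[P]_n) :
  moment_row s (M1 + M2) = moment_row s M1 + moment_row s M2.
Proof.
apply/matrixP=> i j; rewrite [RHS]mxE [LHS]moment_rowE.
rewrite [X in _ = X + _]moment_rowE [X in _ = _ + X]moment_rowE.
by rewrite [X in phi (_ * X) = _]mxE mulrDr linearD.
Qed.

Lemma moment_row0 n s : moment_row s (0 : 'rV[P]_n) = 0.
Proof.
apply/matrixP=> i j; rewrite moment_rowE [X in _ * X]mxE mulr0 linear0.
by rewrite [RHS]mxE.
Qed.

(** Scalars are central in the algebra of polynomials, so constant matrices come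
    out of phi on the right, where the weights of the paths appear. *)
Lemma moment_row_mul m n s (M : 'rV[P]_m) (D : 'M[C]_(m, n)) :
  moment_row s (M *m const_mx_poly N D) = moment_row s M *m D.
Proof.
apply/matrixP=> i j; rewrite moment_rowE [X in _ * X]mxE [RHS]mxE.
rewrite mulr_sumr linear_sum; apply: eq_bigr => l _.
by rewrite moment_rowE [X in _ * (_ * X)]mxE mulrA mulr_malgC linearZ /= mulrC.
Qed.

Lemma moment_row_shift n (u : seq 'I_N) k (M : 'rV[P]_n) :
  moment_row (FMonom (rcons u k)) M = moment_row (FMonom u) (indet R k *: M).
Proof.
apply/matrixP=> i j; rewrite [LHS]moment_rowE [RHS]moment_rowE.
by rewrite [X in _ = phi (_ * X)]mxE -cats1 fmonom_cat mulrA.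
Qed.

Variable vphi : word N -> P.
Hypothesis phi_pos : strictly_positive phi.
Hypothesis vphi_on : orthonormal_polys phi vphi.

Lemma poly_adjC (a : C) : poly_adj (a%:MP : P) = (a^*)%:MP.
Proof.
rewrite /poly_adj msuppC; case: eqP => [->|_].
  by rewrite big_seq_fset0 rmorph0 monalgU0.
by rewrite big_seq_fset1 mcoeffU eqxx /word_rev fm1 -fmoneE.
Qed.

(** The support condition makes this polynomial a constant a > 0, and its norm is
    a^2 = 1 because phi(1) = 1. *)
Lemma orthonormal_polys_nil : vphi (FMonom [::]) = 1.
Proof.
have [phi1 _] := phi_pos; have [vsupp vpos von] := vphi_on.
set o := FMonom [::]; pose a := (vphi o)@_o.
have vE : vphi o = a%:MP.
  have oE : o = mone by rewrite /o -fmoneE.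
  apply/malgP => t; rewrite mcoeffC -oE.
  have [->//|tn] := eqVneq.
  apply/eqP; rewrite mcoeff_eq0; apply/negP => /vsupp.
  by case: t tn => [[|? ?]].
have a_gt0 : 0 < a := vpos o.
have: phi (poly_adj (vphi o) * vphi o) = 1 by have := von o o; rewrite eqxx.
rewrite vE poly_adjC -mpolyCM (CrealP (gtr0_real a_gt0)).
rewrite -[_%:MP]mulr1 mul_malgC linearZ phi1 /= mulr1 => /eqP.
rewrite -expr2 (sqrp_eq1 (ltW a_gt0)) => /eqP ->.
exact: mpolyC1E.
Qed.

(** Since vphi_0 = 1, phi(q) is the inner product of q with vphi_0:
    orthogonality lets only height 0 contribute. *)
Lemma moment_row_nil m : moment_row (FMonom [::]) (Phi vphi m) =
  if m == 0%N then const_mx 1 else 0.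
Proof.
have [_ _ von] := vphi_on.
apply/matrixP=> i j; rewrite moment_rowE mxE -fmoneE mul1r.
set t := nth _ _ _.
have st : size t = m.
  by apply/eqP; rewrite -mem_words mem_nth // size_words.
have := von t (FMonom [::]).
rewrite /inner orthonormal_polys_nil (poly_adjC 1) rmorph1.
rewrite [1%:MP]mpolyC1E mul1r => ->.
by rewrite fmP -size_eq0 st; case: (m == 0%N); rewrite mxE.
Qed.

End MomentRow.

(** * Walks along an itinerary *)

Section Walks.
Variable N : nat.
Local Notation next := Defs.next.
Implicit Types (v : vertex N) (o : seq (option 'I_N)) (e : lstep N).

Definition choices v (c : option 'I_N) : seq (lstep N) :=
  [seq e <- if c is Some k then [:: Transition k] else [:: Level; Rise; Fall]
     | allowed v e].

(** Walks are listed from their first step, because the weight of that step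
    is the rightmost factor of the weight of the walk, hence factors out of sums
    over the continuations; the end point is left free. *)
Fixpoint walks v o : seq (seq (lstep N)) :=
  if o is c :: o' then
    [seq e :: es | e <- choices v c, es <- walks (next v e) o']
  else [:: [::]].

Lemma mem_choices v c e :
  (e \in choices v c) = allowed v e && (transition_letter e == c).
Proof.
rewrite mem_filter; congr andb.
by case: c => [k|]; case: e => // i; rewrite !inE.
Qed.

Lemma mem_walks v o es :
  (es \in walks v o) =
  steps_allowed v es && (map (@transition_letter N) es == o).
Proof.
elim: o v es => [|c o IHo] v [|e es] //=; first by rewrite inE andbF.
  by apply/allpairsPdep => -[? [? [? ? ?]]].
rewrite eqseq_cons andbACA -mem_choices -IHo.
apply/allpairsPdep/andP => [[e' [es' [ein esin [-> ->]]]]|[ein esin]] //.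
by exists e, es.
Qed.

Lemma walks_uniq v o : uniq (walks v o).
Proof.
elim: o v => //= c o IHo v; apply: allpairs_uniq_dep => //.
- by rewrite filter_uniq //; case: c.
- by move=> [e es] [e' es'] _ _ /= [-> ->].
Qed.

(** This undoes the passage from a word to its itinerary: a walk that starts in
    plane i reads one letter, that of the current plane, at each step other than
    a transition. *)
Fixpoint letters (i : 'I_N) o : seq 'I_N :=
  if o is c :: o' then
    if c is Some k then letters k o' else i :: letters i o'
  else [::].

(** Every step but a transition increases the first coordinate by 1 and only
    transitions change the letter, so the height alone depends on more than the
    itinerary. *)
Lemma target_walk v es (o := map (@transition_letter N) es) :
  (target v es).1 = (v.1.1 + size (letters v.1.2 o), last v.1.2 (pmap id o))%N.
Proof.
rewrite {}/o; elim: es v => [|e es IHes] [[n i] m] /=; first by rewrite addn0.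
by case: e => [|k||]; rewrite IHes //= addnS.
Qed.

Lemma letters_itinerary i k (r : seq ('I_N * nat)) :
  letters i (itinerary ((i, k) :: r)) =
  flatten [seq nseq x.2 x.1 | x <- (i, k) :: r].
Proof.
rewrite /=; elim: r i k => [|[j l] r IHr] i k /=.
  by rewrite !cats0; elim: k => //= k ->.
by elim: k => [|k IHk] /=; rewrite ?IHr // IHk.
Qed.

Lemma pmap_itinerary i k (r : seq ('I_N * nat)) :
  pmap id (itinerary ((i, k) :: r)) = [seq x.1 | x <- r].
Proof.
have pmap_nseq l : pmap id (nseq l (None : option 'I_N)) = [::] by elim: l.
rewrite /= pmap_cat pmap_nseq /=.
by elim: r => //= -[j l] r IHr; rewrite pmap_cat pmap_nseq /= IHr.
Qed.

End Walks.

(** * Sums of weights of walks *)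

Section WeightSum.
Variables (R : realType) (N : nat).
Local Notation C := R[i].
Local Notation next := Defs.next.
Variable A : forall n : nat, 'I_N -> 'M[C]_(N ^ n, N ^ n.-1).
Variable B : forall n : nat, 'I_N -> 'M[C]_(N ^ n).

Lemma conform_mx_mul m n p (M : 'M[C]_(m, n)) (D : 'M[C]_(n, p)) : m = 1%N ->
  conform_mx (0 : 'rV_p) (M *m D) = conform_mx (0 : 'rV_n) M *m D.
Proof. by move=> m1; move: M; rewrite m1 => M; rewrite !conform_mx_id. Qed.

(** The condition on the height is not redundant with conform_mx: for N = 1 all
    the weights are 1 x 1, whatever the heights. *)
Definition weight_sum (v : vertex N) (ps : seq (seq (lstep N))) :
    'rV[C]_(N ^ v.2) :=
  \sum_(p <- ps | (target v p).2 == 0%N)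
     conform_mx (0 : 'rV_(N ^ v.2)) (steps_weight A B v p).

Lemma weight_sum_cons v c o :
  weight_sum v (walks v (c :: o)) =
  \sum_(e <- choices v c)
     weight_sum (next v e) (walks (next v e) o) *m step_weight A B v e.
Proof.
rewrite /weight_sum /= big_mkcond big_allpairs_dep; apply: eq_bigr => e _.
rewrite -big_mkcond mulmx_suml; apply: eq_bigr => es /eqP es0.
by rewrite conform_mx_mul // es0.
Qed.

Variables (phi : {scalar ncpoly R N}) (vphi : word N -> ncpoly R N).
Hypothesis phi_pos : strictly_positive phi.
Hypothesis vphi_on : orthonormal_polys phi vphi.
Hypothesis ABP : three_term A B vphi.

(** The walks run through the word of their letters from right to left, so
    removing the first step of the walk removes the last letter of the word,
    which then multiplies Phi; the condition on the transitions says that each of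
    them is allowed. *)
Lemma weight_sum_walks v o :
  path (fun i j => i != j) v.1.2 (pmap id o) ->
  weight_sum v (walks v o) =
  moment_row phi (FMonom (rev (letters v.1.2 o))) (Phi vphi v.2).
Proof.
elim: o v => [|c o IHo] v.
  move=> _; rewrite (moment_row_nil phi_pos vphi_on).
  case: v => [[n i] m]; rewrite /weight_sum /= big_mkcond big_seq1 /=.
  case: eqP => // m0; subst m; rewrite conform_mx_id.
  by apply/matrixP => j l; rewrite !mxE !ord1.
rewrite weight_sum_cons; case: c => [k|] /=.
  case/andP=> ik hp; rewrite /choices /= eq_sym ik big_seq1 IHo //.
  by rewrite mulmx1.
move=> hp; rewrite rev_cons moment_row_shift ABP !moment_rowD !moment_row_mul.
rewrite /choices; case: v hp => [[n i] [|m]] hp /=.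
  (* At height 0 the fall is not allowed, and the last term of the three-term
     relation is 0. *)
  by rewrite !big_cons big_nil addr0 !IHo // addrC moment_row0 mul0mx addr0.
rewrite !big_cons big_nil addr0 !IHo //.
by rewrite addrA; congr (_ + _); rewrite addrC.
Qed.

End WeightSum.

(** * The paths attached to a word *)

Section PathSetWalks.
Variable N : nat.
Variables (s : word N) (i : 'I_N) (k : nat) (r : seq ('I_N * nat)).
Hypothesis rsE : rev (runs s) = (i, k) :: r.

Lemma letters_itinerary_runs : letters i (itinerary ((i, k) :: r)) = rev s.
Proof.
have [-> _ _] := (runsP s (runs s)).1 erefl.
rewrite letters_itinerary -rsE rev_flatten -!map_rev -map_comp.
by congr flatten; apply: eq_map => x /=; rewrite rev_nseq.
Qed.

Lemma path_itinerary_runs :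
  path (fun a b => a != b) i (pmap id (itinerary ((i, k) :: r))).
Proof.
have [_ _ s_sorted] := (runsP s (runs s)).1 erefl.
have: sorted (fun a b => a != b) [seq x.1 | x <- rev (runs s)].
  rewrite map_rev rev_sorted sorted_map; apply: sub_sorted s_sorted => x y /=.
  by rewrite eq_sym.
by rewrite rsE pmap_itinerary.
Qed.

(** The conditions on the first two coordinates of the end point hold for every
    walk along the itinerary. *)
Lemma path_setE (v : vertex N := (0%N, i, 0%N)) :
  path_set s = [set` [seq (v, es) | es <- walks v (itinerary ((i, k) :: r))
                                  & (target v es).2 == 0%N]]%classic.
Proof.
apply/seteqP; rewrite /path_set rsE; split=> -[u es] /=.
  case=> -> esok tE esE; apply/mapP; exists es => //.
  by rewrite mem_filter mem_walks esok esE tE !eqxx.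
case/mapP => es'; rewrite mem_filter mem_walks.
case/and3P => /eqP t0 esok /eqP esE [-> ->]; split=> //.
rewrite [LHS]surjective_pairing t0 target_walk esE letters_itinerary_runs.
rewrite size_rev (pmap_itinerary i) /=.
by have /= -> := last_map (fun x : 'I_N * nat => x.1) r (i, k).
Qed.

End PathSetWalks.

Theorem theorem2p3 (R : realType) (N : nat)
    (phi : {scalar ncpoly R N}) (vphi : word N -> ncpoly R N)
    (A : forall n : nat, 'I_N -> 'M[R[i]]_(N ^ n, N ^ n.-1))
    (B : forall n : nat, 'I_N -> 'M[R[i]]_(N ^ n)) :
  (1 <= N)%N ->
  strictly_positive phi ->
  orthonormal_polys phi vphi ->
  admissible A B ->
  three_term A B vphi ->
  forall s : word N, s != FMonom [::] ->
    moment phi s = \sum_(p \in path_set s) path_weight A B p.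
Proof.
move=> _ phi_pos vphi_on _ ABP s s_neq0.
case rsE: (rev (runs s)) => [|[i k] r].
  have [sE _ _] := (runsP s (runs s)).1 erefl.
  by rewrite fmP sE -[runs s]revK rsE in s_neq0.
rewrite (path_setE rsE) -fsbig_seq; last first.
  by rewrite map_inj_uniq ?filter_uniq ?walks_uniq // => es es' [].
rewrite big_map big_filter.
have pathP := path_itinerary_runs rsE.
have := weight_sum_walks phi_pos vphi_on ABP (v := (0%N, i, 0%N)) pathP.
rewrite (letters_itinerary_runs rsE) revK fmK => /matrixP/(_ 0 0).
(* At height 0, Phi has the single entry vphi_0 = 1. *)
rewrite moment_rowE [X in _ * X]mxE -[nth _ _ _]/(FMonom [::]).
rewrite (orthonormal_polys_nil phi_pos vphi_on) mulr1 /moment => <-.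
by rewrite summxE.
Qed.
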